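(* Let $L$ be a finite-dimensional complex simple Leibniz algebra, let $I$ be the ideal of $L$ generated by squares, and write $L=G\dot{+}I$ as a vector space direct sum, where $G$ is a Lie subalgebra of $L$ (so $G\cong L/I$). Put $n=\dim G$ and $m=\dim I$. Then any derivation $d$ of $L$ can be represented as $d=R_a+\alpha+\triangle$, where $a\in G$, $\triangle: G\to I$ is a linear map (extended by $\triangle|_I=0$), and $\alpha=\lambda\,\mathrm{id}_{I}$ for some $\lambda\in\mathbb{C}$ (extended by $\alpha|_G=0$). In addition, if $n\neq m$, then $\triangle=0$; if $n=m$, then either $\triangle(G)=I$ or $\triangle(G)=0$.
   Context: A (right) Leibniz algebra over a field $F$ is an $F$-vector space $L$ with a bilinear product $[\cdot,\cdot]$ satisfying $[x,[y,z]]=[[x,y],z]-[[x,z],y]$ for all $x,y,z\in L$. Ideals are two-sided. $I$ denotes the ideal of $L$ generated by the squares $[x,x]$, $x\in L$; it coincides with the linear span of the squares, $[L,I]=0$, and $L/I$ is a Lie algebra. $L$ is called simple if its only ideals are $\{0\}$, $I$, $L$ and $[L,L]\neq I$. By the Levi-type theorem for Leibniz algebras (Barnes), a finite-dimensional simple Leibniz algebra in characteristic zero has a decomposition $L=G\dot{+}I$ with $G$ a (simple) Lie subalgebra. A derivation of $L$ is a linear map $d:L\to L$ with $d([x,y])=[d(x),y]+[x,d(y)]$ for all $x,y\in L$. For $a\in L$, $R_a:L\to L$ is the right multiplication operator $R_a(x)=[x,a]$. *)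

(* Defs.v *)
From HB Require Import structures.
From mathcomp Require Import all_boot all_order all_algebra.
From mathcomp Require Import sesquilinear.
From mathcomp Require Import boolp classical_sets.

Set Implicit Arguments.
Unset Strict Implicit.
Unset Printing Implicit Defensive.

Import GRing.Theory.
Local Open Scope ring_scope.

Section Leibniz.
Variables (F : fieldType) (L : vectType F).
Implicit Types (br : {bilinear L -> L -> L}) (J G U V : {vspace L}).
Implicit Types (d : 'End(L)) (S : set L).

Definition leibniz_identity br : Prop :=
  forall x y z, br x (br y z) = br (br x y) z - br (br x z) y.

Definition is_ideal br J : Prop :=
  forall x y, x \in J -> br x y \in J /\ br y x \in J.

Definition is_ideal_generated_by br S J : Prop :=
  [/\ is_ideal br J,
      forall x, S x -> x \in J
    & forall K : {vspace L},
        is_ideal br K -> (forall x, S x -> x \in K) -> (J <= K)%VS].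

(* [xget] chooses a space satisfying the predicate; by [gen_idealP] and
   [gen_ideal_unique] below there is exactly one, so [0%VS] is never used. *)
Definition gen_ideal br S : {vspace L} :=
  xget 0%VS [set J : {vspace L} | is_ideal_generated_by br S J]%classic.

Definition squares br : set L := [set s | exists x, s = br x x]%classic.

Definition squares_ideal br : {vspace L} := gen_ideal br (squares br).

(* Same construction as [prodv] for associative algebras; see
   [bracketv_sub] for its characterization as a span. *)
Definition bracketv br U V : {vspace L} :=
  <<[seq br u v | u <- vbasis U, v <- vbasis V]>>%VS.

Definition leibniz_simple br : Prop :=
  (forall J, is_ideal br J ->
     [\/ J = 0%VS, J = squares_ideal br | J = fullv])
  /\ bracketv br fullv fullv <> squares_ideal br.

Definition is_subalgebra br G : Prop := {in G &, forall x y, br x y \in G}.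

Definition is_lie_subalgebra br G : Prop :=
  [/\ is_subalgebra br G,
      {in G, forall x, br x x = 0}
    & {in G & &, forall x y z,
        br x (br y z) + br y (br z x) + br z (br x y) = 0}].

Definition is_derivation br d : Prop :=
  forall x y, d (br x y) = br (d x) y + br x (d y).

Definition rmul br (a : L) : 'End(L) := linfun (br^~ a).

Lemma rmulE br a x : rmul br a x = br x a.
Proof. exact: (lfunE (applyr br a)). Qed.

Lemma gen_ideal_unique br S J K :
  is_ideal_generated_by br S J -> is_ideal_generated_by br S K -> J = K.
Proof.
move=> [Ji SJ Jm] [Ki SK Km].
by apply/eqP; rewrite eqEsubv Jm ?Km.
Qed.

Lemma gen_idealP br S : is_ideal_generated_by br S (gen_ideal br S).
Proof.
apply: (@xgetPex _ _ [set J | is_ideal_generated_by br S J]%classic).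
pose P (n : nat) := `[< exists J, [/\ is_ideal br J,
  forall x, S x -> x \in J & \dim J = n] >].
have exP : exists n, P n.
  exists (\dim (fullv : {vspace L})); apply/asboolP; exists fullv.
  by split=> // x *; rewrite ?memvf.
case: (ex_minnP exP) => n /asboolP[J [Ji SJ dJ]] nmin.
exists J; split=> // K Ki SK.
apply/capv_idPl/eqP; rewrite eqEdim capvSl /= dJ; apply: nmin.
apply/asboolP; exists (J :&: K)%VS; split=> // x.
  move=> y; rewrite memv_cap => /andP[/Ji-/(_ y)[a b] /Ki-/(_ y)[c e]].
  by rewrite !memv_cap a b c e.
by move=> Sx; rewrite memv_cap SJ ?SK.
Qed.

Lemma squares_idealP br :
  is_ideal_generated_by br (squares br) (squares_ideal br).
Proof. exact: gen_idealP. Qed.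

Lemma memv_bracket br U V :
  {in U & V, forall u v, br u v \in bracketv br U V}.
Proof.
move=> u v /coord_vbasis-> /coord_vbasis->.
rewrite linear_sumlz; apply: memv_suml => i _.
rewrite linear_sumr; apply: memv_suml => j _.
rewrite linearZl_LR linearZr_LR !memvZ // memv_span //.
by apply/allpairsP; exists ((vbasis U)`_i, (vbasis V)`_j); rewrite !memt_nth.
Qed.

Lemma bracketv_sub br U V K :
  (bracketv br U V <= K)%VS <-> {in U & V, forall u v, br u v \in K}.
Proof.
split=> [sub u v Uu Vv | H]; first exact: (subvP sub _ (memv_bracket br Uu Vv)).
apply/span_subvP => _ /allpairsP[[u v] /= [uU vV ->]].
by apply: H; apply: vbasis_mem.
Qed.

End Leibniz.

(* Main.v *)
Require Import Defs.
From HB Require Import structures.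
From mathcomp Require Import all_boot all_order all_algebra.
From mathcomp Require Import sesquilinear complex reals spectral.

Set Implicit Arguments.
Unset Strict Implicit.
Unset Printing Implicit Defensive.

Import GRing.Theory Num.Theory VectorInternalTheory.
Local Open Scope ring_scope.
Local Open Scope complex_scope.

(* Right multiplications are derivations and [R I = 0], so the arguments for Lie
   algebras can be run in L itself, without passing to G. If the trace form
   tr(R_x R_y) vanished, every R_x would be nilpotent (pair it with its
   conjugated semisimple part), and the Engel argument would contradict
   [L, L] = L. As the radical of the form is an ideal containing I, it is I. A
   derivation d then has tr(d R_x) = tr(R_a R_x) for some a, and f = d - R_a
   maps L into the radical I. Hence f [x, y] = [f x, y]: f is an endomorphism
   of the right L-module L, which is a scalar on the irreducible module I
   (Schur), while the kernel and image of its restriction to G are submodules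
   of the irreducible modules G and I. *)

(** * Linear algebra: generalized eigenspaces and conjugated semisimple parts *)

(** In a rank factorization P = A B the factors can be cancelled, so P^2 = P gives B A = 1, and tr P
    = tr (B A). *)
Lemma mxtrace_idempotent (F : fieldType) n (P : 'M[F]_n) :
  P *m P = P -> \tr P = (\rank P)%:R.
Proof.
move=> PP; have: col_base P *m (row_base P *m col_base P) *m row_base P =
  col_base P *m 1%:M *m row_base P.
  by rewrite mulmx1 mulmxA mulmx_base -mulmxA mulmx_base.
move/(row_free_inj (row_base_free P))/(row_full_inj (col_base_full P)) => E.
by rewrite -{1}(mulmx_base P) mxtrace_mulC E mxtrace1.
Qed.

(** Every root of the characteristic polynomial is an eigenvalue, hence 0; the polynomial is X^n,
    and its subleading coefficient is - tr A. *)
Lemma mxtrace_nilpotent (F : closedFieldType) n (A : 'M[F]_n) k :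
  A ^+ k = 0 -> \tr A = 0.
Proof.
case: n A => [|n] A Ak0; first by rewrite /mxtrace big_ord0.
have [rs] := closed_field_poly_normal (char_poly A).
rewrite (monicP (char_poly_monic A)) scale1r => def_chi.
have rs0 : {in rs, forall r, r = 0}.
  move=> r; rewrite -root_prod_XsubC -def_chi -eigenvalue_root_char.
  case/eigenvalueP=> v vA v_neq0.
  have vAk j : v *m A ^+ j = r ^+ j *: v.
    elim: j => [|j IH]; first by rewrite !expr0 mulmx1 scale1r.
    by rewrite !exprSr -[A ^+ j * A]/(A ^+ j *m A) mulmxA IH -scalemxAl vA scalerA.
  have /eqP := vAk k; rewrite Ak0 mulmx0 eq_sym scaler_eq0 (negPf v_neq0) orbF.
  by rewrite expf_eq0 => /andP[_ /eqP].
apply/eqP; rewrite -oppr_eq0 -char_poly_trace // def_chi.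
rewrite big_seq (eq_bigr (fun=> 'X)) => [|r /rs0->]; last by rewrite subr0.
rewrite -big_seq big_const_seq iter_mulr_1 coefXn.
have := size_char_poly A; rewrite def_chi size_prod_XsubC => -[rs_size].
by rewrite count_predT rs_size ltn_eqF.
Qed.

(** Chinese remainders: modulo the product, the [e c] are orthogonal idempotents with sum 1.
    Evaluated at a matrix they become its spectral projections. *)
Lemma partial_fractions (F : fieldType) (s : seq F) N : uniq s ->
  exists e : F -> {poly F},
    (\prod_(c <- s) ('X - c%:P) ^+ N %| 1 - \sum_(c <- s) e c) /\
    {in s, forall c,
      \prod_(b <- s) ('X - b%:P) ^+ N %| ('X - c%:P) ^+ N * e c}.
Proof.
elim: s => [_|a s IH /andP[a_s /IH[e [sum_e mul_e]]]].
  by exists (fun=> 0); split=> //; rewrite big_nil dvd1p.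
set w := \prod_(b <- s) _ in sum_e mul_e.
have /Bezout_eq1_coprimepP[[u t] /= ut1] : coprimep (('X - a%:P) ^+ N) w.
  apply/coprimep_expl; rewrite coprimep_sym coprimep_XsubC.
  apply: contra a_s; rewrite /w => /eqP wa0.
  have: root (\prod_(b <- s) ('X - b%:P)) a; last by rewrite root_prod_XsubC.
  rewrite /root; move/eqP: wa0; rewrite prodrXl horner_exp expf_eq0.
  by case/andP.
(* In u (X - a)^N + t w = 1 the term t w belongs to a; the other term multiplies the idempotents
   already found. *)
pose e' c := if c == a then t * w else u * ('X - a%:P) ^+ N * e c.
have e's : {in s, forall c, e' c = u * ('X - a%:P) ^+ N * e c}.
  by move=> c cs; rewrite /e' ifN //; apply: contraNneq a_s => <-.
exists e'; rewrite !big_cons -/w; split.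
  rewrite big_seq (eq_bigr _ e's) -big_seq -big_distrr /= {1}/e' eqxx.
  have -> : 1 - (t * w + u * ('X - a%:P) ^+ N * \sum_(i <- s) e i) =
     u * ('X - a%:P) ^+ N * (1 - \sum_(i <- s) e i).
    by rewrite -{1}ut1 addrKA mulrBr mulr1.
  by rewrite -mulrA dvdp_mull // dvdp_mul.
move=> c; rewrite inE; case: eqP => [-> _|/eqP ca /= cs].
  by rewrite /e' eqxx mulrCA dvdp_mull.
by rewrite e's // -mulrA mulrCA dvdp_mull // mulrCA dvdp_mul // mul_e.
Qed.

(** Evaluate at M a Bezout relation between the coprime powers of X - b and X - c. *)
Lemma geigenvectors_disjoint (F : fieldType) n (M : 'M[F]_n) (b c : F) j k
    (v : 'rV_n) : b != c ->
  v *m (M - b%:M) ^+ j = 0 -> v *m (M - c%:M) ^+ k = 0 -> v = 0.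
Proof.
case: n M v => [|n] M v bc vb vc; first by rewrite thinmx0.
have /Bezout_eq1_coprimepP[[p q] /= pq1] :
    coprimep (('X - b%:P) ^+ j) (('X - c%:P) ^+ k).
  by rewrite coprimep_expl // coprimep_expr // coprimep_XsubC2 // subr_eq0 eq_sym.
have hX a i : horner_mx M (('X - a%:P) ^+ i) = (M - a%:M) ^+ i.
  by rewrite rmorphXn rmorphB /= horner_mx_X horner_mx_C.
have /(congr1 (fun r => v *m horner_mx M r)) := pq1.
rewrite rmorph1 mulmx1 mulrC [q * _]mulrC rmorphD !rmorphM /= !hX.
by rewrite mulmxDr -!mulmxE !mulmxA vb vc !mul0mx addr0 => <-.
Qed.

(* The [P c] are the projections on the generalized eigenspaces. *)
Lemma spectral_projections (F : closedFieldType) n (M : 'M[F]_n) :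
  exists (s : seq F) (P : F -> 'M[F]_n) (N : nat),
   [/\ uniq s, \sum_(c <- s) P c = 1%:M, forall c, P c *m M = M *m P c
     & {in s, forall c, P c *m (M - c%:M) ^+ N = 0}].
Proof.
case: n M => [|n] M.
  exists [::], (fun=> 0), 0; split=> //; first by rewrite big_nil flatmx0.
  by move=> c; rewrite mulmx0 mul0mx.
have [rs] := closed_field_poly_normal (char_poly M).
rewrite (monicP (char_poly_monic M)) scale1r => def_chi.
(* [size rs] bounds all multiplicities, so the characteristic polynomial divides the product of N-th
   powers, and Cayley-Hamilton applies. *)
set s := undup rs; set N := size rs.
have [e [sum_e mul_e]] := partial_fractions N (undup_uniq rs).
have kill p : \prod_(c <- s) ('X - c%:P) ^+ N %| p -> horner_mx M p = 0.
  move=> wp; have /dvdpP[q ->] : char_poly M %| p.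
    apply: dvdp_trans wp; rewrite prodrXl def_chi.
    have: {subset rs <= s} by move=> r; rewrite mem_undup.
    rewrite /N; elim: {1 2 3}rs => [|r t IH] t_s.
      by rewrite big_nil dvd1p.
    rewrite big_cons exprS dvdp_mul ?IH // => [|b bt].
      by rewrite dvdp_XsubCl root_prod_XsubC t_s ?mem_head.
    by rewrite t_s // inE bt orbT.
  by rewrite rmorphM /= Cayley_Hamilton mulr0.
exists s, (fun c => horner_mx M (e c)), N; split; first exact: undup_uniq.
- have /kill := sum_e; rewrite rmorphB rmorph1 rmorph_sum /= => /eqP.
  by rewrite subr_eq0 => /eqP.
- by move=> c; apply: comm_horner_mx.
move=> c cs; have /kill := mul_e c cs.
by rewrite mulrC rmorphM rmorphXn rmorphB /= horner_mx_X horner_mx_C.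
Qed.

(* [S] is the semisimple part of [M] with conjugated eigenvalues. *)
Lemma conjugate_semisimple_part (C : numClosedFieldType) n (M : 'M[C]_n) :
  exists S : 'M[C]_n,
  [/\ forall c k (v : 'rV_n), v *m (M - c%:M) ^+ k = 0 -> v *m S = c^* *: v,
      forall v : 'rV_n, exists (s : seq C) (v_ : C -> 'rV_n) (N : nat),
        v = \sum_(c <- s) v_ c /\
        {in s, forall c, v_ c *m (M - c%:M) ^+ N = 0}
    & \tr (S *m M) = 0 -> exists k, M ^+ k = 0].
Proof.
have [s [P [N [s_uniq sumP commP killP]]]] := spectral_projections M.
have comm_pow c b k : P c *m (M - b%:M) ^+ k = (M - b%:M) ^+ k *m P c.
  apply: (@commrX _ (P c) (M - b%:M)).
  by apply: commrB; [exact: commP | exact: comm_mx_scalar].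
(* v P b is a generalized eigenvector for both b and c. *)
have orthP b c k (v : 'rV_n) : b \in s -> b != c ->
    v *m (M - c%:M) ^+ k = 0 -> v *m P b = 0.
  move=> bs bc vc; apply: (@geigenvectors_disjoint _ _ M b c N k) => //.
    by rewrite -mulmxA killP // mulmx0.
  by rewrite -mulmxA comm_pow mulmxA vc mul0mx.
have idemP b : b \in s -> P b *m P b = P b.
  move=> bs; rewrite -{3}[P b]mulmx1 -sumP mulmx_sumr (bigD1_seq b) //=.
  rewrite big_seq_cond big1 ?addr0 // => c /andP[cs cb].
  apply/row_matrixP=> i; rewrite !row_mul row0.
  by apply: (@orthP c b N) => //; rewrite -row_mul killP // row0.
exists (\sum_(c <- s) c^* *: P c); split.
- move=> c k v vc; rewrite mulmx_sumr -{2}[v]mulmx1 -sumP mulmx_sumr scaler_sumr.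
  apply: eq_big_seq => b bs; rewrite -scalemxAr.
  have [-> //|bc] := eqVneq b c.
  by rewrite (orthP b c k) // !scaler0.
- move=> v; exists s, (fun c => v *m P c), N; split.
    by rewrite -mulmx_sumr sumP mulmx1.
  by move=> c cs; rewrite -mulmxA killP // mulmx0.
(* P c (M - c) is nilpotent, so only c P c contributes to the trace. The exponent N + 1 leaves a
   factor P c even when N = 0. *)
have trP c : c \in s -> \tr (P c *m M) = c * (\rank (P c))%:R.
  move=> cs; rewrite -{1}[M](subrK c%:M) mulmxDr mxtraceD.
  rewrite (@mxtrace_nilpotent _ _ _ N.+1).
    by rewrite add0r mul_mx_scalar mxtraceZ mxtrace_idempotent ?idemP.
  rewrite [LHS](@exprMn_comm _ (P c) (M - c%:M)).
    rewrite exprSr (exprSr (M - c%:M)) -mulrA [P c * (_ * _)]mulrA.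
    by rewrite [P c * _](killP c cs) mul0r mulr0.
  by have := comm_pow c c 1; rewrite expr1.
(* tr (S M) is the sum of the nonnegative |c|^2 rank (P c). If it vanishes, then P c = 0 for every c
   <> 0 in s, whence M^N = 0. *)
rewrite mulmx_suml raddf_sum /=.
under eq_bigr do rewrite -scalemxAl mxtraceZ.
rewrite (eq_big_seq (fun c => `|c| ^+ 2 * (\rank (P c))%:R)); last first.
  by move=> c /trP ->; rewrite mulrA normCKC.
move/eqP; rewrite psumr_eq0 => [/allP tr0|c _]; last first.
  by rewrite mulr_ge0 ?exprn_ge0 ?ler0n.
exists N; rewrite -[M ^+ N]mul1mx -sumP mulmx_suml big1_seq // => c /= cs.
have := tr0 c cs; rewrite mulf_eq0 expf_eq0 normr_eq0 pnatr_eq0 mxrank_eq0 /=.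
case/orP=> [/eqP c0|/eqP->]; last by rewrite mul0mx.
by have := killP c cs; rewrite c0 raddf0 subr0.
Qed.

(** * Trace of an endomorphism *)

Section Trace.
Variables (F : fieldType) (L : vectType F).
Implicit Types (f g : 'End(L)).

Lemma v2r_lfun f x : v2r (f x) = v2r x *m f2mx f.
Proof. by rewrite unlock /= r2vK. Qed.

Lemma f2mx_eq f (A : 'M_(dim L)) :
  (forall x, v2r (f x) = v2r x *m A) -> f2mx f = A.
Proof.
move=> fA; apply/row_matrixP=> i; rewrite !rowE.
by rewrite -[delta_mx 0 i](@r2vK _ L) -v2r_lfun fA.
Qed.

Lemma f2mx_comp f g : f2mx (f \o g)%VF = f2mx g *m f2mx f.
Proof. by apply: f2mx_eq => x; rewrite lfunE /= !v2r_lfun mulmxA. Qed.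

Definition ltrace f : F := \tr (f2mx f).

Fact ltrace_is_scalar : scalar ltrace.
Proof.
move=> a f g; rewrite /ltrace -linearP /=; congr (\tr _).
apply: f2mx_eq => x; rewrite add_lfunE scale_lfunE linearP /= !v2r_lfun.
by rewrite mulmxDr -scalemxAr.
Qed.
HB.instance Definition _ :=
  GRing.isLinear.Build F 'End(L) F _ ltrace ltrace_is_scalar.

Lemma ltraceC f g : ltrace (f \o g)%VF = ltrace (g \o f)%VF.
Proof. by rewrite /ltrace !f2mx_comp mxtrace_mulC. Qed.

End Trace.

(** * Right multiplications and the ideal of squares *)

Section Leibniz.
Variables (F : fieldType) (L : vectType F) (br : {bilinear L -> L -> L}).
Hypothesis brJ : leibniz_identity br.
Local Notation I := (squares_ideal br).
Local Notation R := (rmul br).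
Implicit Types (x y z : L) (U V W H : {vspace L}) (f d : 'End(L)).

Fact rmul_is_linear : linear R.
Proof.
move=> a x y; apply/lfunP=> z; rewrite !lfunE /= !rmulE !lfunE /= !rmulE.
by rewrite linearP.
Qed.
HB.instance Definition _ := GRing.isLinear.Build F L 'End(L) _ R rmul_is_linear.

(** For f = R y this is the trace form. *)
Definition rtrace f x : F := ltrace (f \o R x)%VF.

Fact rtrace_is_scalar f : scalar (rtrace f).
Proof. by move=> a x y; rewrite /rtrace linearP comp_lfunDr -comp_lfunZr linearP. Qed.
HB.instance Definition _ f :=
  GRing.isLinear.Build F L F _ (rtrace f) (rtrace_is_scalar f).

Lemma rmul_derivation x : is_derivation br (R x).
Proof. by move=> y z; rewrite !rmulE brJ addrC subrK. Qed.

Lemma square_memv x : br x x \in I.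
Proof. by case: (squares_idealP br) => _ sqI _; apply: sqI; exists x. Qed.

(** Polarization. Thus, for an element whose brackets on one side lie in a subspace containing I,
    those on the other side do too. *)
Lemma bracket_sym_memv x y : br x y + br y x \in I.
Proof.
have -> : br x y + br y x = - (br x x + br y y) + br (x + y) (x + y).
  by rewrite linearDl !linearDr /= [br y x + _]addrC addrACA addKr.
by rewrite memvD ?memvN ?memvD ?square_memv.
Qed.

Lemma squares_ideal_ideal : is_ideal br I.
Proof. by case: (squares_idealP br). Qed.

(** The kernel of x |-> R_x is an ideal containing the squares, so minimality of I applies. *)
Lemma rmul_squares x : x \in I -> R x = 0.
Proof.
case: (squares_idealP br) => _ _ /(_ (lker (linfun R))) IR xI.
have kerE y : (y \in lker (linfun R)) = (R y == 0) by rewrite memv_ker lfunE.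
suff /subvP/(_ x xI) : (I <= lker (linfun R))%VS by rewrite kerE => /eqP.
apply: IR => [{xI} y z|y [z ->]]; rewrite !kerE; last first.
  by apply/eqP/lfunP=> w; rewrite !rmulE !lfunE /= brJ subrr.
move/eqP/lfunP=> Ry0.
have {Ry0} Ry0 w : br w y = 0 by rewrite -rmulE Ry0 lfunE.
by split; apply/eqP/lfunP=> w; rewrite rmulE lfunE /= brJ !Ry0 linear0l subrr.
Qed.

Lemma bracket_squares x y : y \in I -> br x y = 0.
Proof. by move=> yI; rewrite -rmulE rmul_squares // lfunE. Qed.

(** Expand R_[y,z] = R_z R_y - R_y R_z and d R_y = R_y d + R_(d y); the other terms cancel by
    cyclicity. For d = R_x this is invariance of the trace form. *)
Lemma trace_derivation_bracket d y z : is_derivation br d ->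
  ltrace (d \o R (br y z)) = - ltrace (R (d y) \o R z).
Proof.
move=> der.
have -> : R (br y z) = (R z \o R y)%VF - (R y \o R z)%VF.
  by apply/lfunP=> x; rewrite !lfunE /= !lfunE /= !rmulE brJ !lfunE /= !rmulE.
rewrite comp_lfunDr comp_lfunNr linearB /= !comp_lfunA.
have -> : (d \o R y = R y \o d + R (d y))%VF.
  by apply/lfunP=> x; rewrite !lfunE /= !lfunE /= !rmulE der.
rewrite comp_lfunDl linearD /= -[in X in X - _]comp_lfunA ltraceC -comp_lfunA.
by rewrite ltraceC -!comp_lfunA [ltrace (_ \o (d \o _))]ltraceC -comp_lfunA opprD addNKr.
Qed.

End Leibniz.

(** * Engel's theorem for right multiplications *)

Section Engel.
Variables (F : fieldType) (L : vectType F) (br : {bilinear L -> L -> L}).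
Hypothesis brJ : leibniz_identity br.
Local Notation I := (squares_ideal br).
Local Notation R := (rmul br).
Implicit Types (x y z : L) (U V W H : {vspace L}) (f d : 'End(L)).

Lemma bracketvS U V W H :
  (U <= V)%VS -> (W <= H)%VS -> (bracketv br U W <= bracketv br V H)%VS.
Proof.
move=> /subvP UV /subvP WH; apply/bracketv_sub => u w uU wW.
by apply: memv_bracket; [exact: UV | exact: WH].
Qed.

(* The last clause says that [H] acts nilpotently on the right of [L]. *)
Definition engel_subspace H : Prop :=
  [/\ (I <= H)%VS, is_subalgebra br H
    & forall U, bracketv br U H = U -> U = 0%VS].

(** The chain L, [L, H], [[L, H], H], ... decreases strictly until it enters H; its last term not
    inside H supplies y. *)
Lemma engel_normalizer H : engel_subspace H -> H <> fullv ->
  exists2 y, y \notin H & {in H, forall h, br y h \in H}.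
Proof.
case=> _ _ nilH H_proper.
have descend n U : (\dim U <= n)%N -> (bracketv br U H <= U)%VS ->
    ~~ (U <= H)%VS -> exists2 y, y \notin H & {in H, forall h, br y h \in H}.
  elim: n U => [|n IH] U dimU stU UH.
    by move: dimU UH; rewrite leqn0 dimv_eq0 => /eqP->; rewrite sub0v.
  have [WH|WH] := boolP (bracketv br U H <= H)%VS.
    have [y yU yH] := subvPn UH; exists y => // h hH.
    by apply: (subvP WH); apply: memv_bracket.
  apply: IH WH; last exact: bracketvS.
  rewrite -ltnS (leq_trans _ dimU) // ltn_neqAle dimvS // andbT.
  apply: contra UH => /eqP dimW.
  suff /nilH-> : bracketv br U H = U by rewrite sub0v.
  by apply/eqP; rewrite eqEdim stU dimW leqnn.
apply: (descend _ fullv (leqnn _)); first exact: subvf.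
by apply/negP=> fH; apply: H_proper; apply/eqP; rewrite eqEsubv subvf.
Qed.

Lemma engel_extend H y :
    (forall x, exists k, forall v, iter k (R x) v = 0) ->
    engel_subspace H -> {in H, forall h, br y h \in H} ->
  engel_subspace (H + <[y]>)%VS.
Proof.
move=> nilR [IH subH nilH] yH.
(* Modulo I, which lies in H, [h, y] is - [y, h]. *)
have Hy : {in H, forall h, br h y \in H}.
  move=> h hH; rewrite -[br h y](addrK (br y h)) memvB ?yH //.
  exact: (subvP IH) (bracket_sym_memv _ _ _).
split=> [||U defU].
- exact: subv_trans IH (addvSl _ _).
- move=> _ _ /memv_addP[h hH [_ /vlineP[a ->] ->]] /memv_addP[k kH [_ /vlineP[b ->] ->]].
  (* All products even land in H, because [y, y] lies in I. *)
  apply: (subvP (addvSl _ _)).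
  rewrite linearDl !linearDr /= !linearZl_LR !linearZr_LR /=.
  have yyH := subvP IH _ (square_memv br y).
  by rewrite !memvD ?memvZ ?memvZ ?yyH ?yH ?Hy ?subH.
(* [W] is stable under [R y], so [U = W + R y @: U] iterates to
   [U = W + (R y)^k @: U], which is [W] once [(R y)^k = 0]. *)
pose W := bracketv br U H.
have WU : (W <= U)%VS by rewrite -defU bracketvS // addvSl.
have Wy : {in W, forall w, br w y \in W}.
  move=> w; rewrite -rmulE memv_preim; apply/subvP/bracketv_sub => u h uU hH.
  rewrite -memv_preim rmul_derivation // !rmulE memvD ?memv_bracket ?Hy //.
  by rewrite -defU memv_bracket // (subvP (addvSr _ _)) // memv_line.
have UWy : {in U, forall u, exists2 u', u' \in U & u - br u' y \in W}.
  move=> u; rewrite -{1}defU => uU.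
  suff /subvP/(_ u uU)/memv_addP[w wW [_ /memv_imgP[u' u'U ->] ->]] :
      (bracketv br U (H + <[y]>) <= W + R y @: U)%VS.
    by exists u'; rewrite // rmulE addrK.
  apply/bracketv_sub => v _ vU /memv_addP[h hH [_ /vlineP[a ->] ->]].
  rewrite linearDr /= memv_add ?memv_bracket // linearZr_LR /=.
  by rewrite memvZ // -rmulE memv_img.
have UWk k : {in U, forall u, exists2 u', u' \in U & u - iter k (R y) u' \in W}.
  elim: k => [|k IHk] u uU; first by exists u; rewrite //= subrr mem0v.
  have [u1 u1U u1W] := UWy u uU; have [u2 u2U u2W] := IHk u1 u1U.
  exists u2 => //=; rewrite -(subrK (br u1 y) u) -addrA memvD //.
  by rewrite rmulE -linearBl Wy.
have [k Rk] := nilR y.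
apply: nilH; apply/eqP; rewrite eqEsubv WU; apply/subvP => u /(UWk k)[u' _].
by rewrite Rk subr0.
Qed.

(** Starting from I, which acts as zero, adjoin normalizing vectors until L itself is an
    [engel_subspace]; its last clause then applies to U = L. *)
Lemma nilpotent_rmul_perfect :
    (forall x, exists k, forall v, iter k (R x) v = 0) ->
  bracketv br fullv fullv = fullv -> fullv = 0%VS :> {vspace L}.
Proof.
move=> nilR perfL.
suff [_ _] : engel_subspace fullv by apply.
have grow n H : (\dim {:L} - \dim H <= n)%N -> engel_subspace H ->
    engel_subspace fullv.
  elim: n H => [|n IHn] H codimH eH.
    suff <- : H = fullv by [].
    by apply/eqP; rewrite eqEdim subvf -subn_eq0 -leqn0.
  have [<- //|/eqP H_proper] := eqVneq H fullv.
  have [y yH /(engel_extend nilR eH)] := engel_normalizer eH H_proper.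
  apply: IHn; rewrite -ltnS (leq_trans _ codimH) //.
  have dimH : (\dim H < \dim (H + <[y]>))%N.
    rewrite ltn_neqAle dimvS ?addvSl // andbT; apply: contra yH => dimH.
    have /eqP-> : H == (H + <[y]>)%VS by rewrite eqEdim addvSl (eqP dimH) /=.
    by rewrite (subvP (addvSr _ _)) // memv_line.
  by rewrite ltn_sub2l // (leq_trans dimH) // dimvS // subvf.
apply: (grow _ I (leqnn _)); split=> // [x y xI _|U <-].
  by case: (squares_ideal_ideal y xI).
apply/eqP; rewrite -subv0; apply/bracketv_sub => u x _ xI.
by rewrite bracket_squares ?mem0v.
Qed.
End Engel.

(** * Cartan's criterion *)

Section Cartan.
Variables (C : numClosedFieldType) (L : vectType C).
Variable (br : {bilinear L -> L -> L}).
Hypothesis brJ : leibniz_identity br.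
Local Notation R := (rmul br).
Implicit Types (x y z : L) (f d : 'End(L)).

Lemma iter_lfunD f k x y : iter k f (x + y) = iter k f x + iter k f y.
Proof. by elim: k => //= k ->; rewrite linearD. Qed.

Lemma v2r_iter f c k x :
  v2r (iter k (f - c *: \1)%VF x) = v2r x *m (f2mx f - c%:M) ^+ k.
Proof.
elim: k => [|k IHk]; first by rewrite mulmx1.
rewrite exprSr [RHS]mulmxA -IHk /= v2r_lfun; congr (_ *m _).
apply: f2mx_eq => v; rewrite !lfunE /= !lfunE /= lfunE /= lfunE.
by rewrite linearB linearZ /= v2r_lfun mulmxBr mul_mx_scalar.
Qed.

(** As (d - a - b)[y, z] = [(d - a) y, z] + [y, (d - b) z], each term lowers one exponent: induction
    on p + q. *)
Lemma derivation_geigen d a b p q y z : is_derivation br d ->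
  iter p (d - a *: \1)%VF y = 0 -> iter q (d - b *: \1)%VF z = 0 ->
  iter (p + q) (d - (a + b) *: \1)%VF (br y z) = 0.
Proof.
move=> der; have dE e v : (d - e *: \1)%VF v = d v - e *: v.
  by rewrite !lfunE /= !lfunE /= lfunE /= lfunE.
have iter0 e k : iter k (d - e *: \1)%VF 0 = 0.
  by elim: k => //= k ->; rewrite linear0.
have [n] := ubnP (p + q); elim: n p q y z => // n IHn p q y z.
case: p => [|p] pqn yp zq; first by rewrite /= in yp; rewrite yp linear0l iter0.
case: q pqn zq => [|q] pqn zq.
  by rewrite /= in zq; rewrite zq linear0r iter0.
rewrite addSn iterSr dE der.
have -> : br (d y) z + br y (d z) - (a + b) *: br y z =
    br ((d - a *: \1)%VF y) z + br y ((d - b *: \1)%VF z).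
  rewrite !dE linearBl linearBr /= linearZl_LR linearZr_LR /=.
  by rewrite addrACA -opprD scalerDl.
have pqn' : (p + q.+1 < n)%N by rewrite addSn in pqn.
rewrite iter_lfunD IHn -?iterSr // add0r addnS -addSn.
by apply: IHn; rewrite -?iterSr // addSn -addnS.
Qed.

(* The conjugated semisimple part of [d] is again a derivation, because
   generalized eigenvalues add up under the bracket. *)
Lemma conjugate_derivation d : is_derivation br d ->
  exists2 S, is_derivation br S
    & ltrace (S \o d)%VF = 0 -> exists k, forall v, iter k d v = 0.
Proof.
move=> der.
have [S [S_eig span_eig S_nil]] := conjugate_semisimple_part (f2mx d).
pose s : 'End(L) := Hom S.
have sE c k v : iter k (d - c *: \1)%VF v = 0 -> s v = c^* *: v.
  move=> vk; apply: (can_inj v2rK); rewrite v2r_lfun linearZ /=.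
  by apply: (S_eig c k); rewrite -v2r_iter vk linear0.
have span v : exists (t : seq C) (v_ : C -> L) (N : nat),
    v = \sum_(c <- t) v_ c /\
    {in t, forall c, iter N (d - c *: \1)%VF (v_ c) = 0}.
  have [t [w [N [vE wN]]]] := span_eig (v2r v).
  exists t, (fun c => r2v (w c)), N; split.
    apply: (can_inj v2rK); rewrite vE [RHS]linear_sum /=.
    by apply: eq_bigr => c _; rewrite r2vK.
  move=> c ct; apply: (can_inj v2rK).
  by rewrite v2r_iter r2vK wN // linear0.
exists s => [y z|].
  (* By bilinearity, generalized eigenvectors suffice; there conjugation of a + b is additive. *)
  have [ty [y_ [p [-> yp]]]] := span y; have [tz [z_ [q [-> zq]]]] := span z.
  rewrite linear_sumlz [LHS]linear_sum [s (\sum_(c <- ty) _)]linear_sum /=.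
  rewrite !linear_sumlz -big_split /=; apply: eq_big_seq => a /yp ya.
  rewrite linear_sumr [LHS]linear_sum [s (\sum_(c <- tz) _)]linear_sum /=.
  rewrite !linear_sumr -big_split /=; apply: eq_big_seq => b /zq zb.
  rewrite (sE _ _ _ (derivation_geigen der ya zb)) (sE _ _ _ ya) (sE _ _ _ zb).
  by rewrite linearZl_LR linearZr_LR /= -scalerDl rmorphD.
rewrite ltraceC /ltrace f2mx_comp => /S_nil[k dk]; exists k => v.
apply: (can_inj v2rK); rewrite linear0.
by have := v2r_iter d 0 k v; rewrite raddf0 subr0 dk mulmx0 scale0r subr0.
Qed.

(** With S the derivation attached to R_x, the form y |-> tr (S R_y) vanishes on brackets, hence at
    x, so R_x is nilpotent. *)
Lemma cartan_criterion : bracketv br fullv fullv = fullv ->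
  (forall x y, ltrace (R x \o R y)%VF = 0) -> fullv = 0%VS :> {vspace L}.
Proof.
move=> perfL tr0; apply: (nilpotent_rmul_perfect brJ) => // x.
have [S derS] := conjugate_derivation (rmul_derivation brJ x).
apply.
have /subvP/(_ x (memvf x)) : (fullv <= lker (linfun (rtrace br S : L -> C^o)))%VS.
  rewrite -perfL; apply/bracketv_sub => y z _ _.
  by rewrite memv_ker lfunE /= /rtrace trace_derivation_bracket // tr0 oppr0.
by rewrite memv_ker lfunE => /eqP.
Qed.
End Cartan.

(** * The trace form through its Gram matrix *)

Section TraceForm.
Variables (F : fieldType) (L : vectType F) (br : {bilinear L -> L -> L}).
Local Notation R := (rmul br).
Local Notation n := (dim L).
Implicit Types (x y z : L) (f d : 'End(L)).

Let e (j : 'I_n) : L := r2v (delta_mx 0 j).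
Let K : 'M[F]_n := \matrix_(i, j) rtrace br (R (e i)) (e j).
Let coords f : 'rV[F]_n := \row_j rtrace br f (e j).

Lemma rtraceC x y : rtrace br (R x) y = rtrace br (R y) x.
Proof. exact: ltraceC. Qed.

Let rtrace_coords f x : rtrace br f x = \sum_j rtrace br f (e j) * v2r x 0 j.
Proof.
have {1}-> : x = \sum_j v2r x 0 j *: e j.
  apply: (can_inj v2rK); rewrite linear_sum {1}[v2r x]row_sum_delta /=.
  by apply: eq_bigr => j _; rewrite linearZ /= r2vK.
rewrite linear_sum; apply: eq_bigr => j _ /=.
by rewrite [LHS]linearZ /= mulrC.
Qed.

Let coords_mul f x : coords f *m (v2r x)^T = (rtrace br f x)%:M.
Proof.
apply/rowP=> i; rewrite ord1 !mxE eqxx mulr1n rtrace_coords.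
by apply: eq_bigr => j _; rewrite !mxE.
Qed.

Let gramE x : v2r x *m K = coords (R x).
Proof.
apply/rowP=> j; rewrite !mxE rtraceC rtrace_coords.
by apply: eq_bigr => i _; rewrite !mxE mulrC rtraceC.
Qed.

Lemma trace_form_radical :
  exists J : {vspace L}, forall x, x \in J <-> forall y, rtrace br (R x) y = 0.
Proof.
exists (lker (Hom K : 'End(L))) => x; rewrite memv_ker.
rewrite -(inj_eq (can_inj v2rK)) linear0 v2r_lfun /= gramE.
split=> [/eqP Rx0 y|Rx0]; last by apply/eqP/rowP=> j; rewrite !mxE Rx0.
have := coords_mul (R x) y; rewrite Rx0 mul0mx => /matrixP/(_ 0 0).
by rewrite !mxE eqxx mulr1n => ->.
Qed.

(* Solvability of the linear system with Gram matrix [K]: a solution [c] of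
   the homogeneous system is a vector of the radical. *)
Lemma rtrace_represented f :
    (forall x, (forall y, rtrace br (R x) y = 0) -> rtrace br f x = 0) ->
  exists a, forall x, rtrace br f x = rtrace br (R a) x.
Proof.
move=> f_rad; suff /submxP[D fD] : (coords f <= K)%MS.
  exists (r2v D) => x.
  have := coords_mul (R (r2v D)) x; rewrite -gramE r2vK -fD coords_mul.
  by move/matrixP/(_ 0 0); rewrite !mxE eqxx !mulr1n.
rewrite submxE; apply/eqP/rowP=> j; set c := col j (cokermx K).
have Kc : K *m c = 0 by rewrite /c colE mulmxA mulmx_coker mul0mx.
transitivity ((coords f *m c) 0 0).
  by rewrite /c colE mulmxA -colE [in RHS]mxE.
have cE : c = (v2r (r2v c^T : L))^T by rewrite r2vK trmxK.
rewrite cE coords_mul !mxE eqxx mulr1n; apply: f_rad => y.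
have := coords_mul (R y) (r2v c^T); rewrite -cE -gramE -mulmxA Kc mulmx0.
by move/matrixP/(_ 0 0); rewrite !mxE eqxx mulr1n rtraceC => ->.
Qed.
End TraceForm.

(** * Consequences of simplicity *)

Lemma stable_eigenvector (C : numClosedFieldType) (L : vectType C)
    (f : 'End(L)) (U : {vspace L}) : (f @: U <= U)%VS -> U != 0%VS ->
  exists a u, [/\ u \in U, u != 0 & f u = a *: u].
Proof.
move=> fU U0; pose g : 'End(subvs_of U) := linfun (vsproj U \o f \o vsval).
have [|a /eigenvalueP[v va v0]] := @eigenvalue_closed _ _ (f2mx g).
  (* In dimension 0 the coordinate vector of [vpick U] is empty, so [vpick U] = 0. *)
  rewrite lt0n; apply: contra U0 => /eqP U0.
  rewrite -vpick0; apply/eqP.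
  rewrite -(vsprojK (memv_pick U)) -[vsproj U _]v2rK.
  have -> : v2r (vsproj U (vpick U)) = 0.
    by apply/rowP=> j; have := ltn_ord j; rewrite [X in (_ < X)%N]U0.
  by rewrite !linear0.
exists a, (vsval (r2v v)); split; first exact: subvsP.
  apply: contra_neq v0 => v0; apply: (can_inj r2vK); apply: subvs_inj.
  by rewrite v0 !linear0.
have /(congr1 (fun w => vsval (r2v w))) := va.
rewrite -[v in v *m _](@r2vK _ (subvs_of U)) -v2r_lfun v2rK lfunE /= !linearZ /=.
by rewrite vsprojK // (subvP fU) // memv_img // subvsP.
Qed.

Section Simple.
Variables (C : numClosedFieldType) (L : vectType C).
Variable (br : {bilinear L -> L -> L}).
Hypotheses (brJ : leibniz_identity br) (simpleL : leibniz_simple br).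
Local Notation I := (squares_ideal br).
Local Notation R := (rmul br).
Implicit Types (x y z : L) (f d : 'End(L)) (J : {vspace L}).

(** [L, L] is an ideal other than I; if it were 0, all squares would vanish and I = 0 = [L, L]. *)
Lemma simple_perfect : bracketv br fullv fullv = fullv.
Proof.
case: simpleL => ideals LL_neqI.
have idLL : is_ideal br (bracketv br fullv fullv).
  by move=> x y _; rewrite !memv_bracket ?memvf.
case: (ideals _ idLL) => // LL0; case: LL_neqI; rewrite LL0; apply/esym/eqP.
have [_ _ Imin] := squares_idealP br.
by rewrite -subv0 -LL0; apply: Imin => // _ [x ->]; rewrite memv_bracket ?memvf.
Qed.

Lemma squares_proper : I <> fullv.
Proof. by case: simpleL => _ LL_neqI If; apply: LL_neqI; rewrite simple_perfect. Qed.

Lemma simple_neq0 : fullv <> 0%VS :> {vspace L}.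
Proof.
by move=> L0; apply: squares_proper; apply/eqP; rewrite eqEsubv subvf L0 sub0v.
Qed.

(** Serves as irreducibility of I: since [L, I] = 0, right submodules of I are ideals. *)
Lemma simple_sub_ideal J : is_ideal br J -> (J <= I)%VS -> J = 0%VS \/ J = I.
Proof.
case: simpleL => ideals _ /ideals[-> _|-> _|-> fI]; [by left|by right|right].
by apply/eqP; rewrite eqEsubv fI subvf.
Qed.

(** Serves as simplicity of L/I. *)
Lemma simple_sup_ideal J : is_ideal br J -> (I <= J)%VS -> J = I \/ J = fullv.
Proof.
case: simpleL => ideals _ /ideals[-> |-> _|-> _]; [|by left|by right].
by rewrite subv0 => /eqP->; left.
Qed.

Lemma trace_form_radicalE x : (forall y, rtrace br (R x) y = 0) <-> x \in I.
Proof.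
have [J memJ] := trace_form_radical br.
have IJ : (I <= J)%VS.
  apply/subvP=> y /(rmul_squares brJ) Ry; apply/memJ => z.
  by rewrite Ry /rtrace comp_lfun0l linear0.
suff <- : J = I by rewrite memJ.
have idJ : is_ideal br J.
  move=> y z yJ; have zyJ : br z y \in J.
    apply/memJ => w; apply/eqP; rewrite -oppr_eq0 /rtrace; apply/eqP.
    rewrite -[br z y](rmulE br) -(trace_derivation_bracket brJ z w (rmul_derivation brJ y)).
    exact: (proj1 (memJ y) yJ).
  split=> //; rewrite -[br y z](addrK (br z y)) memvB //.
  exact: (subvP IJ) (bracket_sym_memv _ _ _).
case: (simple_sup_ideal idJ IJ) => // Jf; case: simple_neq0.
apply: (cartan_criterion brJ simple_perfect) => y z.
by apply: (proj1 (memJ y)); rewrite Jf memvf.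
Qed.

(** x |-> tr (d R_x) vanishes on the radical I, so some a represents it. For E = d - R_a, tr (R_(E
    x) R_y) = - tr (E R_[x,y]) = 0 puts E x in the radical. *)
Lemma derivation_inner_mod_squares d : is_derivation br d ->
  exists a, forall x, d x - br x a \in I.
Proof.
move=> der.
have [x /trace_form_radicalE/(rmul_squares brJ) Rx|a da] := @rtrace_represented _ _ br d.
  by rewrite /rtrace Rx comp_lfun0r linear0.
exists a => x; pose E := d - R a.
have derE : is_derivation br E.
  move=> y z; rewrite !lfunE /= !lfunE /= der rmul_derivation //.
  by rewrite linearBl linearBr /= opprD addrACA.
have -> : d x - br x a = E x by rewrite !lfunE /= !lfunE /= rmulE.
apply/trace_form_radicalE => y; rewrite /rtrace; apply/eqP.
rewrite -oppr_eq0 -trace_derivation_bracket //.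
have := da (br x y); rewrite /rtrace /E comp_lfunDl comp_lfunNl linearB /= => ->.
by rewrite subrr.
Qed.

(** Schur's lemma: an eigenspace of f in I is a nonzero ideal, hence I. *)
Lemma module_endomorphism_scalar f :
    (forall x, f x \in I) -> (forall x y, f (br x y) = br (f x) y) ->
  exists a, {in I, forall x, f x = a *: x}.
Proof.
move=> fI fM; have [I0|I_neq0] := eqVneq I 0%VS.
  by exists 0 => x; rewrite I0 memv0 => /eqP->; rewrite linear0 scaler0.
have fII : (f @: I <= I)%VS by apply/subvP=> _ /memv_imgP[x _ ->].
have [a [u [uI u_neq0 fu]]] := stable_eigenvector fII I_neq0.
pose J := (I :&: lker (f - a *: \1%VF))%VS; exists a.
have memJ x : (x \in J) = (x \in I) && (f x == a *: x).
  by rewrite memv_cap memv_ker !lfunE /= !lfunE /= lfunE /= lfunE subr_eq0.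
have idJ : is_ideal br J.
  move=> x y; rewrite memJ => /andP[xI /eqP fx].
  rewrite (bracket_squares brJ y xI) mem0v memJ fM fx linearZl_LR eqxx andbT.
  by split=> //; case: (squares_ideal_ideal y xI).
have uJ : u \in J by rewrite memJ uI fu eqxx.
case: (simple_sub_ideal idJ (capvSl _ _)) => [J0|J_I x].
  by move: uJ u_neq0; rewrite J0 memv0 => ->.
by rewrite -J_I memJ => /andP[_ /eqP].
Qed.

(** * Module maps restricted to the complement G *)

Section Complement.
Variable G : {vspace L}.
Hypotheses (subG : is_subalgebra br G) (GI : (G + I)%VS = fullv).
Hypothesis capGI : (G :&: I)%VS = 0%VS.
Variable f : 'End(L).
Hypotheses (fI : forall x, f x \in I).
Hypothesis fM : forall x y, f (br x y) = br (f x) y.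

(** Since I acts as zero, stability under right multiplication by G gives stability under L. *)
Lemma bracket_complement x : exists2 g, g \in G & forall y, br y x = br y g.
Proof.
have /memv_addP[g gG [i iI ->]] : x \in (G + I)%VS by rewrite GI memvf.
by exists g => // y; rewrite linearDr /= (bracket_squares brJ _ iI) addr0.
Qed.

Lemma module_map_image : (f @: G)%VS = 0%VS \/ (f @: G)%VS = I.
Proof.
apply: simple_sub_ideal => [_ x /memv_imgP[g gG ->]|]; last first.
  by apply/subvP=> _ /memv_imgP[x _ ->].
rewrite (bracket_squares brJ x (fI g)) mem0v; split=> //.
have [h hG ->] := bracket_complement x.
by rewrite -fM memv_img ?subG.
Qed.

(** The kernel in G is only a right G-submodule; adding I makes it an ideal, to which simplicity of
    L/I applies. *)
Lemma module_map_kernel : (G <= lker f)%VS \/ (G :&: lker f)%VS = 0%VS.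
Proof.
pose J := (G :&: lker f + I)%VS.
have IJ : (I <= J)%VS := addvSr _ _.
have idJ : is_ideal br J.
  move=> x y xJ; suff xyJ : br x y \in J.
    split=> //; rewrite -[br y x](addrK (br x y)) memvB //.
    exact: (subvP IJ) (bracket_sym_memv _ _ _).
  have /memv_addP[k /memv_capP[kG kf] [i iI ->]] := xJ.
  have [g gG ->] := bracket_complement y.
  rewrite linearDl memv_add //=; last by case: (squares_ideal_ideal g iI).
  rewrite memv_cap subG //= memv_ker fM.
  by move: kf; rewrite memv_ker => /eqP->; rewrite linear0l.
case: (simple_sup_ideal idJ IJ) => [J_I|Jf]; [right|left].
  by apply/eqP; rewrite -subv0 -capGI subv_cap capvSl -[X in (_ <= X)%VS]J_I addvSl.
apply/subvP=> g gG; have: g \in J by rewrite Jf memvf.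
case/memv_addP=> k /memv_capP[kG kf] [i iI g_ki].
have : i \in (G :&: I)%VS.
  by rewrite memv_cap iI andbT -(addKr k i) -g_ki addrC memvB.
by rewrite capGI memv0 g_ki => /eqP->; rewrite addr0.
Qed.

End Complement.

End Simple.

(** * Assembling the decomposition *)

Theorem theorem3p4 (R : realType) (L : vectType R[i])
    (br : {bilinear L -> L -> L}) (G : {vspace L}) (d : 'End(L)) :
  let I := squares_ideal br in
  let n := \dim G in
  let m := \dim I in
  leibniz_identity br ->
  leibniz_simple br ->
  is_lie_subalgebra br G ->
  (G + I)%VS = fullv ->
  directv (G + I) ->
  is_derivation br d ->
  exists (a : L) (lambda : R[i]) (alpha Delta : 'End(L)),
    [/\ a \in G,
        {in I, forall x, alpha x = lambda *: x} /\
          {in G, forall x, alpha x = 0},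
        (Delta @: G <= I)%VS /\ {in I, forall x, Delta x = 0},
        d = rmul br a + alpha + Delta
      & (n <> m -> Delta = 0) /\
        (n = m -> (Delta @: G)%VS = I \/ (Delta @: G)%VS = 0%VS)].
Proof.
move=> I n m brJ simpleL [subG _ _] GI /directv_addP capGI der.
have [b db] := derivation_inner_mod_squares brJ simpleL der.
have [a aG ba] := bracket_complement brJ GI b.
pose f := d - rmul br a.
have fE x : f x = d x - br x b by rewrite ba !lfunE /= !lfunE /= rmulE.
have fI x : f x \in I by rewrite fE.
have fM x y : f (br x y) = br (f x) y.
  (* f is a derivation, and its second Leibniz term vanishes because [L, I] = 0. *)
  have fxy : f (br x y) = br (f x) y + br x (f y).
    rewrite !fE ba der -(rmulE br a) rmul_derivation // !rmulE.
    by rewrite linearBl linearBr /= !ba opprD addrACA.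
  by rewrite fxy (bracket_squares brJ x (fI y)) addr0.
have [lambda f_lambda] := module_endomorphism_scalar brJ simpleL fI fM.
have capIG : (I :&: G)%VS = 0%VS by rewrite capvC.
have pi_0 U V x : (U :&: V)%VS = 0%VS -> x \in V -> daddv_pi U V x = 0.
  move=> UV xV; have VU : (V :&: U)%VS = 0%VS by rewrite capvC.
  have := daddv_pi_add UV (subvP (addvSr U V) _ xV).
  by rewrite (daddv_pi_id VU xV) -[RHS]add0r => /addIr.
pose Delta := (f \o daddv_pi G I)%VF.
have DeltaE : {in G, forall x, Delta x = f x}.
  by move=> x xG; rewrite lfunE /= daddv_pi_id.
have DeltaG : (Delta @: G)%VS = (f @: G)%VS by apply: eq_in_limg.
have Delta0 : (f @: G)%VS = 0%VS -> Delta = 0.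
  move=> fG0; apply/lfunP=> x; rewrite !lfunE /=; apply/eqP.
  by rewrite -memv0 -fG0 memv_img ?memv_pi.
(* alpha is lambda times the projection onto I along G, so it agrees with f on I, as [Delta] does on
   G. *)
exists a, lambda, (lambda *: daddv_pi I G), Delta; split=> //.
- split=> x xU; rewrite !lfunE /=; first by rewrite daddv_pi_id.
  by rewrite pi_0 ?scaler0.
- split=> [|x xI]; first by apply/subvP=> _ /memv_imgP[x _ ->]; rewrite lfunE /=.
  by rewrite lfunE /= pi_0 ?linear0.
- apply/lfunP=> x; rewrite !lfunE /= !lfunE /= lfunE /=.
  have := @daddv_pi_add _ _ _ _ x capGI; rewrite GI memvf => /(_ isT) xE.
  rewrite -f_lambda ?memv_pi // -addrA -linearD.
  by rewrite [_ + daddv_pi G I x]addrC xE /= fE ba rmulE addrC subrK.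
split=> [nm|_]; last first.
  by rewrite DeltaG; case: (module_map_image brJ simpleL subG GI fI fM); [right|left].
apply: Delta0.
(* If f(G) = I, either f kills G and I = 0, or f is injective on G and n = m. *)
case: (module_map_image brJ simpleL subG GI fI fM) => // fG_I.
case: (module_map_kernel brJ simpleL subG GI capGI fM) => [kG|kG].
  by apply/eqP; rewrite -lkerE.
by case: nm; rewrite /n -(limg_dim_eq kG) fG_I.
Qed.
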